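(* The poset of equivalence relations on finite sets under the non-consecutive embedding order is well quasi-ordered.
   Context: An equivalence relation is a pair $(X,\rho)$ where $X$ is a set and $\rho\subseteq X\times X$ is reflexive, symmetric and transitive. The non-consecutive embedding order is defined by: $(X,\rho)\le (Y,\sigma)$ if and only if there is an injective function $f:X\to Y$ such that for all $x,y\in X$, $(x,y)\in\rho$ if and only if $(f(x),f(y))\in\sigma$. Two equivalence relations $(X,\rho)$, $(Y,\sigma)$ are isomorphic if there is a bijection $f:X\to Y$ such that for all $x,y\in X$, $(x,y)\in\rho\Leftrightarrow (f(x),f(y))\in\sigma$; isomorphic equivalence relations are considered equal, so the equivalence relations on finite sets form a poset under $\le$. A poset is well quasi-ordered if it contains no infinite antichains and no infinite (strictly) descending chains. *)

(* Defs.v *)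
From HB Require Import structures.
From Stdlib Require Import RelationClasses.
From mathcomp Require Import all_boot all_order.
From mathcomp Require Import boolp classical_sets cardinality.

Set Implicit Arguments.
Unset Strict Implicit.
Unset Printing Implicit Defensive.

Import Order.TTheory.
Local Open Scope classical_set_scope.
Local Open Scope order_scope.

(* The carrier is a [Type] with [finite_set [set: _]] rather than a [finType]:
   with [finType], universe constraints forbid the type [equivClass] below from
   being a [choiceType], hence a [porderType]. *)
Record finEquiv := FinEquiv {
  fe_carrier :> Type;
  fe_finite : finite_set [set: fe_carrier];
  fe_rel : fe_carrier -> fe_carrier -> Prop;
  fe_equiv : Equivalence fe_rel }.

Definition embeds (E F : finEquiv) : Prop :=
  exists2 f : E -> F, injective f &
    forall x y : E, fe_rel x y <-> fe_rel (f x) (f y).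

Definition isomorphic (E F : finEquiv) : Prop :=
  exists2 f : E -> F, bijective f &
    forall x y : E, fe_rel x y <-> fe_rel (f x) (f y).

Lemma isomorphic_refl E : isomorphic E E.
Proof. by exists id => //; exists id. Qed.

Lemma isomorphic_sym E F : isomorphic E F -> isomorphic F E.
Proof.
case=> f [g fK gK] fP; exists g; first by exists f.
by move=> x y; rewrite (propext (fP _ _)) !gK.
Qed.

Lemma isomorphic_trans F E G :
  isomorphic E F -> isomorphic F G -> isomorphic E G.
Proof.
case=> f fb fP [g gb gP]; exists (g \o f); first exact: bij_comp.
by move=> x y; rewrite (propext (fP _ _)) (propext (gP _ _)).
Qed.

Lemma isomorphic_embeds E F : isomorphic E F -> embeds E F.
Proof. by case=> f fb fP; exists f => //; exact: bij_inj. Qed.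

Lemma embeds_trans F E G : embeds E F -> embeds F G -> embeds E G.
Proof.
case=> f fi fP [g gi gP]; exists (g \o f); first exact: inj_comp.
by move=> x y; rewrite (propext (fP _ _)) (propext (gP _ _)).
Qed.

Lemma finite_inj_surj (T : Type) (h : T -> T) :
  finite_set [set: T] -> injective h -> forall y, exists x, h x = y.
Proof.
move=> Tfin hi y; apply: contrapT => /forallNP hy; apply: infinite_nat.
pose it n := iter n h y.
have it_inj : injective it.
  elim=> [|m IH] [|n] //= e; first by case: (hy (it n)).
    by case: (hy (it m)).
  by rewrite (IH n) //; apply: hi.
rewrite -(eq_finite_set (inj_card_eq (in2W it_inj))).
exact: sub_finite_set Tfin.
Qed.

Lemma embeds_anti E F : embeds E F -> embeds F E -> isomorphic E F.
Proof.
case=> f fi fP [g gi _]; exists f => //.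
have fs y : exists x, f x = y.
  have [x fgx] := finite_inj_surj (fe_finite F) (inj_comp fi gi) y.
  by exists (g x).
have [k kP] := choice fs.
by exists k => // x; apply: fi; rewrite kP.
Qed.

(* Isomorphism classes of finite equivalence relations. *)
Record equivClass := EquivClass {
  ec_set : set finEquiv;
  ec_setP : exists E, ec_set = [set F | isomorphic E F] }.

Definition iso_class (E : finEquiv) : equivClass :=
  EquivClass (ex_intro _ E erefl).

Definition ec_le (A B : equivClass) : bool :=
  `[< exists E F, [/\ ec_set A E, ec_set B F & embeds E F] >].

HB.instance Definition _ := gen_eqMixin equivClass.
HB.instance Definition _ := gen_choiceMixin equivClass.

Lemma equivClass_inj (A B : equivClass) : ec_set A = ec_set B -> A = B.
Proof.
case: A B => [A pA] [B pB] /= eAB; subst B.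
by congr EquivClass; exact: Prop_irrelevance.
Qed.

Lemma equivClassP (A : equivClass) : exists E, A = iso_class E.
Proof. by have [E eA] := ec_setP A; exists E; apply: equivClass_inj. Qed.

Lemma iso_class_eq E F : iso_class E = iso_class F <-> isomorphic E F.
Proof.
split=> [eEF|EF].
  change (ec_set (iso_class E) F); rewrite eEF; exact: isomorphic_refl.
apply: equivClass_inj; apply/seteqP; split=> G /=.
  exact/isomorphic_trans/isomorphic_sym.
exact: isomorphic_trans.
Qed.

Lemma iso_class_le E F : ec_le (iso_class E) (iso_class F) <-> embeds E F.
Proof.
split=> [/asboolP[E' [F' [/= EE' FF' E'F']]]|EF].
  apply: embeds_trans (isomorphic_embeds EE') _.
  by apply: embeds_trans E'F' _; exact/isomorphic_embeds/isomorphic_sym.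
by apply/asboolP; exists E, F; split => //=; exact: isomorphic_refl.
Qed.

Lemma ec_le_refl : reflexive ec_le.
Proof.
move=> A; have [E ->] := equivClassP A.
exact/iso_class_le/isomorphic_embeds/isomorphic_refl.
Qed.

Lemma ec_le_anti : antisymmetric ec_le.
Proof.
move=> A B; have [E ->] := equivClassP A; have [F ->] := equivClassP B.
move=> /andP[/iso_class_le EF /iso_class_le FE].
exact/iso_class_eq/embeds_anti.
Qed.

Lemma ec_le_trans : transitive ec_le.
Proof.
move=> B A C; have [E ->] := equivClassP A; have [F ->] := equivClassP B.
have [G ->] := equivClassP C => /iso_class_le FE /iso_class_le EG.
exact/iso_class_le/(embeds_trans FE).
Qed.

Fact equivClass_display : Order.disp_t. Proof. exact: Order.Disp tt tt. Qed.

HB.instance Definition _ := Order.Le_isPOrder.Build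
  equivClass_display equivClass ec_le_refl ec_le_anti ec_le_trans.

Definition antichain d (T : porderType d) (A : set T) : Prop :=
  forall x y, A x -> A y -> x <> y -> x >< y.

Definition well_quasi_ordered d (T : porderType d) : Prop :=
  ~ (exists2 A : set T, infinite_set A & antichain A) /\
  ~ (exists u : nat -> T, forall n, u n.+1 < u n).

(* Main.v *)
Require Import Defs.
From mathcomp Require Import all_boot all_order.
From mathcomp Require Import boolp classical_sets functions cardinality.

(** Up to isomorphism a finite equivalence relation is the Young diagram of its
    class sizes listed in nonincreasing order, and containment of diagrams gives
    an embedding; so it suffices that every sequence of Young diagrams has an
    earlier member contained in a later one. If the first diagram, with at most
    [r] rows and at most [c] columns, is contained in no later one, then every
    later diagram omits a cell of the [r] by [c] rectangle, and is therefore
    determined by its first [r] row lengths and its first [c] column lengths: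
    Dickson's lemma for vectors of [r + c] natural numbers applies. *)

Set Implicit Arguments.
Unset Strict Implicit.
Unset Printing Implicit Defensive.

Import Order.TTheory.

Lemma exists_min (P : nat -> Prop) :
  (exists n, P n) -> exists2 m, P m & forall k, P k -> m <= k.
Proof.
case=> n Pn; have ex : exists n, `[< P n >] by exists n; apply/asboolP.
case: (ex_minnP ex) => m /asboolP Pm min_m.
by exists m => // k Pk; apply/min_m/asboolP.
Qed.

(** Every tail of [h] attains its minimum; each next term of [g] is a position where the tail beyond
    the previous term is minimal. *)
Lemma nondecreasing_subsequence (h : nat -> nat) :
  exists2 g : nat -> nat, {homo g : i j / i < j}
    & {homo h \o g : i j / i <= j}.
Proof.
have /choice[m mP] (N : nat) :
    exists m, N <= m /\ forall k, N <= k -> h m <= h k.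
  have [|_ [m Nm <-] mmin] :=
    @exists_min (fun v => exists2 m, N <= m & h m = v).
    by exists (h N), N.
  by exists m; split=> // k Nk; apply: mmin; exists k.
pose g n := iter n (fun x => m x.+1) (m 0).
have gS i : g i < g i.+1 by have [] := mP (g i).+1.
exists g; first exact: (homo_ltn ltn_trans gS).
apply: (homo_leq leqnn leq_trans) => i.
have gmin k : g i <= k -> h (g i) <= h k.
  case: i => [|i] /=; first by have [_] := mP 0; move=> + _; apply.
  have [+ min_m le_k] := mP (g i).+1; move=> le_m; apply: min_m.
  exact: leq_trans le_m le_k.
exact/gmin/ltnW.
Qed.

(** Each further coordinate costs one more extraction, which keeps the earlier coordinates
    nondecreasing. *)
Lemma dickson (d : nat) (w : nat -> nat -> nat) :
  exists2 g : nat -> nat, {homo g : i j / i < j}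
    & forall k, k < d -> {homo (fun n => w (g n) k) : i j / i <= j}.
Proof.
elim: d => [|d [g gmono gP]]; first by exists id.
have [h hmono hP] := nondecreasing_subsequence (fun n => w (g n) d).
exists (g \o h) => [i j ij|k]; first exact/gmono/hmono.
rewrite ltnS leq_eqVlt => /predU1P[-> //|kd] i j ij.
by apply: gP => //; exact: (ltnW_homo hmono).
Qed.

(* A Young diagram is encoded by its row lengths [f 0], [f 1], etc. *)
Definition partition_shape (f : nat -> nat) : Prop :=
  {homo f : i j / i <= j >-> j <= i} /\ exists r, f r = 0.

(** The rows longer than [v] form an initial segment; their number [m] is the length of the column
    of index [v]. *)
Lemma column_length (f : nat -> nat) (v : nat) : partition_shape f ->
  exists m, forall k, (f k <= v) = (m <= k).
Proof.
case=> fmono [r fr0].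
have [|m fm min_m] := @exists_min (fun k => f k <= v).
  by exists r; rewrite fr0.
exists m => k; apply/idP/idP => [/min_m //|mk].
exact: leq_trans (fmono _ _ mk) fm.
Qed.

Lemma partition_shape_good (u : nat -> nat -> nat) :
  (forall n, partition_shape (u n)) ->
  exists i j, i < j /\ forall k, u i k <= u j k.
Proof.
move=> u_shape; apply: contrapT => bad.
have /choice[col colP] (p : nat * nat) :=
  column_length p.2 (u_shape p.1).
have [u0mono [r u0r]] := u_shape 0.
(* Otherwise all rows of [u n] of index below [r] have length at least [u 0 0], so [u n] contains
   [u 0], whose rows from [r] on are empty. *)
have narrow n k : 0 < n -> r <= k -> u n k < u 0 0.
  move=> n_gt0 rk; rewrite ltnNge; apply/negP => le00.
  apply: bad; exists 0, n; split=> // l.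
  have [rl|lr] := leqP r l.
    by have := u0mono _ _ rl; rewrite u0r leqn0 => /eqP ->.
  have [unmono _] := u_shape n.
  apply: leq_trans (u0mono 0 l _) _ => //; apply: leq_trans le00 _.
  by apply: unmono; exact: leq_trans (ltnW lr) rk.
(* The first [r] rows, then the columns; the shift to [n.+1] skips [u 0], to which [narrow] does not
   apply. *)
pose w n k := if k < r then u n.+1 k else col (n.+1, k - r).
have [g gmono gP] := dickson (r + u 0 0) w.
apply: bad; exists (g 0).+1, (g 1).+1; split=> [|k].
  by rewrite ltnS gmono.
have [rk|kr] := leqP r k; last first.
  by have := gP k (ltn_addr _ kr) _ _ (leq0n 1); rewrite /w kr.
(* Let [v] be the length of row [k] in the later diagram. As [v < u 0 0], column [v] is a
   coordinate; its length is at most [k] in the later diagram, hence also in the earlier one, whose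
   row [k] thus has length at most [v]. *)
have lt_uk := narrow (g 1).+1 k isT rk.
have := gP (r + u (g 1).+1 k).
rewrite ltn_add2l => /(_ lt_uk) /(_ _ _ (leq0n 1)).
rewrite /w ltnNge leq_addr /= addKn => le_col.
rewrite (colP ((g 0).+1, _)); apply: leq_trans le_col _.
by rewrite -(colP ((g 1).+1, _)).
Qed.

(* [c] identifies [E] with the cells [(i, j)], [j < f i], of the diagram, the
   classes being the rows. *)
Definition diagram_coding (E : finEquiv) (f : nat -> nat)
    (c : E -> nat * nat) : Prop :=
  [/\ injective c,
      forall x, (c x).2 < f (c x).1,
      forall i j, j < f i -> exists x, c x = (i, j)
    & forall x y, fe_rel x y <-> (c x).1 = (c y).1].

Lemma diagram_embeds (E F : finEquiv) f g
    (c : E -> nat * nat) (d : F -> nat * nat) :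
  diagram_coding f c -> diagram_coding g d -> (forall k, f k <= g k) ->
  embeds E F.
Proof.
move=> [c_inj c_lt _ cR] [_ _ d_surj dR] fg.
have /choice[h hP] x : exists y, d y = c x.
  have [y dy] := d_surj _ _ (leq_trans (c_lt x) (fg _)).
  by exists y; rewrite dy -surjective_pairing.
exists h => [x y hxy|x y]; first by apply: c_inj; rewrite -!hP hxy.
by rewrite cR dR !hP.
Qed.

(** Number the carrier by ['I_n] and sort the classes by nonincreasing size; the cell of an element
    is the position of its class, then its position within the class. *)
Lemma finEquiv_diagram (E : finEquiv) :
  exists f, partition_shape f /\ exists c : E -> nat * nat, diagram_coding f c.
Proof.
have [n /card_set_bijP[e [e_lt e_inj e_surj]]] :=
  proj1 (finite_setP _) (fe_finite E).
pose o (x : E) : 'I_n := Ordinal (e_lt x I).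
have o_inj : injective o by move=> x y [/e_inj]; apply; rewrite inE.
have /choice[b bP] (i : 'I_n) : exists x, o x = i.
  by have [x _ ex] := e_surj i (ltn_ord i); exists x; apply: val_inj.
have oK x : b (o x) = x by apply: o_inj; rewrite bP.
pose R (i j : 'I_n) := `[< fe_rel (b i) (b j) >].
have [Er Es Et] := fe_equiv E.
have eqR : {in [set: 'I_n]%SET & &, equivalence_rel R}.
  move=> x y z _ _ _; split; first exact/asboolP.
  by move/asboolP=> xy; apply/asboolP/asboolP; apply: Et => //; exact: Es.
pose P := equivalence_partition R [set: 'I_n]%SET.
have /and3P[/eqP cov tiP _] : finset.partition P [set: 'I_n]%SET :=
  equivalence_partitionP eqR.
have pbR x y : (y \in finset.pblock P x) = R x y.
  by apply: pblock_equivalence_partition => //; rewrite inE.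
have pbP x : finset.pblock P x \in P by rewrite pblock_mem // cov inE.
have xpb x : x \in finset.pblock P x by rewrite mem_pblock cov inE.
pose ge_card (A B : {set 'I_n}) := #|B| <= #|A|.
pose s := sort ge_card (enum P).
have s_mem B : (B \in s) = (B \in P) by rewrite mem_sort mem_enum.
have s_uniq : uniq s by rewrite sort_uniq enum_uniq.
have ge_tr : transitive ge_card by move=> A B C AB BC; exact: leq_trans BC AB.
have s_sorted : sorted ge_card s.
  by apply: sort_sorted => A B; exact: leq_total.
(* The default [finset.set0] makes every row past the last class empty. *)
pose f i := #|nth finset.set0 s i|.
pose c x :=
  (index (finset.pblock P (o x)) s, index (o x) (enum (finset.pblock P (o x)))).
exists f; split; first split.
- move=> i j ij; rewrite /f.
  have [js|sj] := ltnP j (size s); last by rewrite (nth_default _ sj) cards0.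
  apply: (sorted_leq_nth ge_tr _ _ s_sorted) => //.
    by move=> A; exact: leqnn.
  exact: leq_ltn_trans js.
- by exists (size s); rewrite /f nth_default // cards0.
have nthc x : nth finset.set0 s (c x).1 = finset.pblock P (o x).
  by rewrite nth_index // s_mem.
have c1P x y :
    (c x).1 = (c y).1 -> finset.pblock P (o x) = finset.pblock P (o y).
  by move=> cxy; rewrite -!nthc cxy.
exists c; split.
- move=> x y cxy; apply: o_inj.
  have pbxy := c1P x y (congr1 fst cxy).
  have := congr1 snd cxy; rewrite /= pbxy => /(index_inj (o x)).
  by apply; rewrite mem_enum // -pbxy.
- by move=> x; rewrite /f nthc cardE index_mem mem_enum.
- move=> i j ji.
  have i_lt : i < size s.
    rewrite ltnNge; apply/negP => si; move: ji.
    by rewrite /f nth_default // cards0.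
  have BP : nth finset.set0 s i \in P by rewrite -s_mem mem_nth.
  set B := nth _ s i in BP.
  have [y0 _] : exists y0, y0 \in B by apply/card_gt0P; exact: leq_ltn_trans ji.
  rewrite /f cardE in ji.
  have yB : nth y0 (enum B) j \in B by rewrite -mem_enum mem_nth.
  exists (b (nth y0 (enum B) j)).
  by rewrite /c bP (def_pblock tiP BP yB) !index_uniq // enum_uniq.
- move=> x y; have -> : fe_rel x y <-> R (o x) (o y).
    by rewrite /R !oK; split=> /asboolP.
  rewrite -pbR -(eq_pblock _ tiP) ?cov ?inE //.
  by split=> [/eqP cxy|/c1P ->//]; rewrite /= cxy.
Qed.

Lemma equivClass_good (u : nat -> equivClass) :
  exists i j, i < j /\ (u i <= u j)%O.
Proof.
have /choice[E EP] n := equivClassP (u n).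
have /choice[f fP] n := finEquiv_diagram (E n).
have [i [j [ij fij]]] := partition_shape_good (fun n => proj1 (fP n)).
exists i, j; split=> //; rewrite (EP i) (EP j).
have [_ [c cP]] := fP i; have [_ [d dP]] := fP j.
exact/iso_class_le/(diagram_embeds cP dP).
Qed.

Theorem theorem3p4 : well_quasi_ordered equivClass.
Proof.
split=> [[A /infiniteP/card_leP/unsquash h A_anti]|[u u_dec]].
  (* An injective sequence in [A]: its good pair is distinct yet comparable. *)
  pose u (n : nat) : equivClass := val (h (to_setT n)).
  have uA n : A (u n) by exact: set_valP.
  have u_inj : injective u.
    move=> m n /val_inj /(@inj _ _ _ h); rewrite !inE => /(_ I I).
    exact: (@inj _ _ setT to_setT _ _ (in_setT _) (in_setT _)).
  have [i [j [ij le_uij]]] := equivClass_good u.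
  have neq_u : u i <> u j by move/u_inj => eij; rewrite eij ltnn in ij.
  by have := A_anti _ _ (uA i) (uA j) neq_u; rewrite /Order.comparable le_uij.
have [i [j [ij le_uij]]] := equivClass_good u.
have gt_tr : forall y x z : equivClass, (y < x -> z < y -> z < x)%O.
  by move=> y x z yx zy; exact: lt_trans zy yx.
have lt_uji := homo_ltn gt_tr u_dec ij.
by have := lt_le_trans lt_uji le_uij; rewrite ltxx.
Qed.
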